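(* Let $G$ and $H$ be non-isomorphic finite abelian groups of the same order $n=p_1^{u_1}\cdots p_k^{u_k}$ (with $p_1,\dots,p_k$ distinct primes), each with minimum generating set of size $2$. Then $\Gamma(G)\cong\Gamma(H)$ if and only if, for each prime $p_i\mid n$, the Sylow $p_i$-subgroups $S_{p_i}(G)$ and $S_{p_i}(H)$ are either both cyclic or both non-cyclic.
   Context: The generating graph $\Gamma(G)$ of a group $G$ is the simple graph with vertex set $G$ in which two distinct vertices $x,y$ are adjacent if and only if $\langle x,y\rangle=G$. ''Minimum generating set of size $2$'' means that the smallest size of a generating set is $2$. $S_{p}(G)$ denotes the Sylow $p$-subgroup of $G$. $\Gamma(G)\cong\Gamma(H)$ denotes graph isomorphism. *)

(* Defs.v *)
From HB Require Import structures.
From mathcomp Require Import all_boot all_fingroup all_solvable.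
Set Implicit Arguments.
Unset Strict Implicit.
Unset Printing Implicit Defensive.
Local Open Scope group_scope.

Record sgraph := SGraph {
  vertex : finType;
  adj : rel vertex;
  adj_sym : symmetric adj;
  adj_irrefl : irreflexive adj
}.

Definition graph_iso (X Y : sgraph) : Prop :=
  exists2 f : vertex X -> vertex Y,
    bijective f & forall x y, adj (f x) (f y) = adj x y.

Section GeneratingGraph.
Variables (gT : finGroupType) (G : {group gT}).

Definition gen_adj : rel (subg_of G) :=
  fun x y => (x != y) && (<<[set sgval x; sgval y]>> == G).

Lemma gen_adj_sym : symmetric gen_adj.
Proof. by move=> x y; rewrite /gen_adj eq_sym setUC. Qed.

Lemma gen_adj_irrefl : irreflexive gen_adj.
Proof. by move=> x; rewrite /gen_adj eqxx. Qed.

(* The vertices are the elements of the subtype [subg G], i.e. of G itself,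
   not those of the ambient type gT. *)
Definition generating_graph : sgraph := SGraph gen_adj_sym gen_adj_irrefl.

End GeneratingGraph.

(* Main.v *)
(** Adjacency of [x] and [y] only depends on [G] modulo its Frattini subgroup.
    Write [G = <[a]> \x <[b]>] with [#[b] %| #[a]]; the Sylow [p]-subgroup is
    cyclic iff [p] does not divide [#[b]].

    If [x] is not isolated, its neighbours are the lifts of the generators of
    the cyclic group [G / <[x]>], so its degree is
    [#[x] * totient #|G : <[x]>|]; as [#|G|] is fixed, the degree determines
    the primes dividing [#|G : <[x]>|].  A prime [p] with noncyclic Sylow
    subgroup divides all these indices, whereas if the Sylow subgroup is cyclic
    the index [#[b]] of [<[a]>] is prime to [p].

    Conversely, if the types agree, [G] and [H] both map onto one group
    [<[u]> \x <[v]>] with kernels inside their Frattini subgroups; any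
    bijection matching the fibres is a graph isomorphism. *)
Require Import Defs.
From mathcomp Require Import all_boot all_fingroup all_solvable.
Set Implicit Arguments.
Unset Strict Implicit.
Unset Printing Implicit Defensive.
Local Open Scope group_scope.

(** * Arithmetic: the ratio of [totient n] to [n] determines the primes dividing [n] *)

(** Prime by prime: the factor [p.-1 * p ^ e.-1] of the totient, times [p], is [p ^ e * p.-1]. *)
Lemma totient_radical n : (0 < n)%N ->
  (totient n * \prod_(p <- primes n) p = n * \prod_(p <- primes n) p.-1)%N.
Proof.
move=> n_gt0; rewrite totientE // [X in _ = (X * _)%N](prod_prime_decomp n_gt0).
rewrite prime_decompE big_map -!big_split /=; apply: eq_big_seq => p.
rewrite -logn_gt0 => logn_gt0.
by rewrite -mulnA -expnSr prednK // mulnC.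
Qed.

Lemma prime_in_prod_primes (s : seq nat) p :
  prime p -> all prime s -> (p %| \prod_(q <- s) q)%N -> p \in s.
Proof.
move=> p_pr; elim: s => [|q s IHs] /=.
  by rewrite big_nil dvdn1 => _ /eqP p1; rewrite p1 in p_pr.
case/andP=> q_pr s_pr; rewrite big_cons Euclid_dvdM // dvdn_prime2 // inE.
by case/orP=> [-> // | /(IHs s_pr) ->]; rewrite orbT.
Qed.

(** Every factor [q.-1] is positive and smaller than [p]. *)
Lemma prime_ndvd_prod_pred (s : seq nat) p :
    prime p -> all prime s -> {in s, forall q, (q <= p)%N} ->
  ~~ (p %| \prod_(q <- s) q.-1)%N.
Proof.
move=> p_pr; elim: s => [|q s IHs] /=.
  by rewrite big_nil dvdn1 => _ _; apply: contraTneq p_pr => ->.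
case/andP=> q_pr s_pr le_p; rewrite big_cons Euclid_dvdM // negb_or.
rewrite IHs // => [|r r_s]; last by rewrite le_p // inE r_s orbT.
have q_gt1 := prime_gt1 q_pr; rewrite andbT gtnNdvd //.
  by rewrite -ltnS prednK // ltnW.
by rewrite prednK ?le_p ?mem_head // ltnW.
Qed.

(* After cancelling the common primes, the largest prime of [s] missing from
   [t] would divide the right-hand side but not the left-hand side. *)
Lemma prod_pred_sub (s t : seq nat) :
    uniq s -> uniq t -> all prime s -> all prime t ->
    (\prod_(p <- s) p.-1 * \prod_(p <- t) p =
       \prod_(p <- t) p.-1 * \prod_(p <- s) p)%N ->
  {subset s <= t}.
Proof.
move=> Us Ut s_pr t_pr eq_st.
pose s' := [seq p <- s | p \notin t]; pose t' := [seq p <- t | p \notin s].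
pose c := [seq p <- s | p \in t].
have c_t: perm_eq c [seq p <- t | p \in s].
  apply: uniq_perm; rewrite ?filter_uniq // => p.
  by rewrite !mem_filter andbC.
have splits (F : nat -> nat) :
    (\prod_(p <- s) F p = \prod_(p <- c) F p * \prod_(p <- s') F p)%N.
  by rewrite (bigID (mem t)) !big_filter.
have splitt (F : nat -> nat) :
    (\prod_(p <- t) F p = \prod_(p <- c) F p * \prod_(p <- t') F p)%N.
  by rewrite (perm_big _ c_t) (bigID (mem s)) !big_filter.
have c_pr: all prime c.
  by apply/allP=> p; rewrite mem_filter => /andP[_ /(allP s_pr)].
have prod_gt0 (F : nat -> nat) :
  {in c, forall p, 0 < F p}%N -> (0 < \prod_(p <- c) F p)%N.
  by move=> F_gt0; rewrite big_seq prodn_cond_gt0.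
have eq_st': (\prod_(p <- s') p.-1 * \prod_(p <- t') p =
       \prod_(p <- t') p.-1 * \prod_(p <- s') p)%N.
  apply/eqP; rewrite -(eqn_pmul2l (_ : 0 < \prod_(p <- c) p.-1 * \prod_(p <- c) p)%N).
    by move/eqP: eq_st; rewrite !splits !splitt mulnACA [X in _ == X]mulnACA.
  rewrite muln_gt0 !prod_gt0 // => p /(allP c_pr) p_pr; first exact: prime_gt0.
  by rewrite -ltnS prednK ?prime_gt1 ?prime_gt0.
have [s'_nil | s'_ncons] := eqVneq s' [::].
  move=> p p_s; apply: contraTT isT => pnt.
  by have: p \in s' by [rewrite mem_filter pnt]; rewrite s'_nil.
have [P P_s' leP]: exists2 P, P \in s' & {in s', forall q, q <= P}%N.
  case: s' s'_ncons {eq_st' splits} => // q0 r _.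
  have [P _ maxP] :=
    @arg_maxnP (seq_sub (q0 :: r)) (SeqSub (mem_head q0 r)) predT val isT.
  by exists (val P) => [|q q_r]; [exact: valP | exact: (maxP (SeqSub q_r))].
have /andP[P_nt P_s] : (P \notin t) && (P \in s) by move: P_s'; rewrite mem_filter.
have P_pr := allP s_pr P P_s.
have: (P %| \prod_(p <- s') p.-1 * \prod_(p <- t') p)%N.
  by rewrite eq_st' dvdn_mull // (big_rem P) //= dvdn_mulr.
have sub_pr (a : pred nat) r : all prime r -> all prime (filter a r).
  by move=> /allP r_pr; apply/allP=> p; rewrite mem_filter => /andP[_ /r_pr].
rewrite Euclid_dvdM // (negPf (prime_ndvd_prod_pred _ _ _)) ?sub_pr //=.
move/(prime_in_prod_primes P_pr); rewrite sub_pr // => /(_ isT).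
by rewrite mem_filter P_s.
Qed.

(** Multiplying by both radicals turns the hypothesis into an identity between products over primes,
    to which [prod_pred_sub] applies in each direction. *)
Lemma totient_ratio_primes m n :
  (0 < m)%N -> (0 < n)%N -> (totient m * n = totient n * m)%N ->
  primes m =i primes n.
Proof.
have sub a b : (0 < a)%N -> (0 < b)%N -> (totient a * b = totient b * a)%N ->
    {subset primes a <= primes b}.
  move=> a_gt0 b_gt0 eq_ab.
  apply: prod_pred_sub; rewrite ?primes_uniq ?all_prime_primes //.
  apply/eqP; rewrite -(eqn_pmul2l (_ : 0 < a * b)%N) ?muln_gt0 ?a_gt0 //.
  rewrite [X in _ == (X * _)%N]mulnC mulnACA [X in _ == X]mulnACA.
  by rewrite -!totient_radical // mulnACA [X in _ == X]mulnACA eq_ab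
             [X in _ == (_ * X)%N]mulnC.
move=> m_gt0 n_gt0 eq_mn p; apply/idP/idP; apply: sub => //.
Qed.

(** * Preimages, Hall subgroups and abelian groups of rank two *)

Lemma card_morphpre_set (aT rT : finGroupType) (D : {group aT})
    (f : {morphism D >-> rT}) (A : {set rT}) :
  A \subset f @* D -> #|f @*^-1 A| = (#|'ker f| * #|A|)%N.
Proof.
move=> sAfD.
rewrite -sum1_card (partition_big f (mem A)) => [|x]; last first.
  by rewrite inE => /andP[_]; rewrite inE.
rewrite mulnC -sum_nat_const; apply: eq_bigr => y Ay.
have /morphimP[x Dx _ y_fx] := subsetP sAfD y Ay.
rewrite sum1_card -(card_rcoset _ x) -morphimK ?sub1set // morphim_set1 // -y_fx.
apply: eq_card => z; rewrite !inE unfold_in /= !inE -andbA.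
by congr (_ && _); rewrite andb_idl // => /eqP ->.
Qed.

(** The image of [P] in [G / K] is a [pi]-group inside a [pi^']-group, hence trivial. *)
Lemma sub_Hall_index (gT : finGroupType) (pi : nat_pred) (G K P : {group gT}) :
    K <| G -> pi^'.-nat #|G : K| -> P \subset G -> pi.-group P -> P \subset K.
Proof.
move=> nKG pi'GK sPG piP.
have [sKG nKG'] := andP nKG.
rewrite -quotient_sub1 ?(subset_trans sPG) //.
rewrite -(setIidPl (quotientS K sPG)) coprime_TIg //=.
by rewrite (pnat_coprime (quotient_pgroup K piP)) // card_quotient.
Qed.

Lemma abelian_rank2 (gT : finGroupType) (G : {group gT}) :
    abelian G -> 'm(G) = 2 ->
  exists a b : gT, <[a]> \x <[b]> = G /\ (#[b] %| #[a])%N.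
Proof.
move=> abG mG; have [bs defG ord_bs] := abelian_structure abG.
have := size_abelian_type abG; rewrite -grank_abelian // mG -ord_bs size_map.
have := abelian_type_dvdn_sorted G; rewrite -ord_bs.
case: bs {ord_bs} defG => [|a [|b [|]]] //=; rewrite !big_cons big_nil dprodg1 andbT.
by move=> defG dvd_ba _; exists a, b.
Qed.

(** * Direct products of two cyclic groups *)

Section CyclicDprod.

Variables (gT : finGroupType) (G : {group gT}) (a b : gT).
Hypothesis defG : <[a]> \x <[b]> = G.
Hypothesis dvd_ba : #[b] %| #[a].

Lemma cdprod_abelian : abelian G.
Proof.
have [_ <- cab _] := dprodP defG.
by rewrite abelianM !cycle_abelian.
Qed.

Lemma cdprod_memPl : a \in G.
Proof. by have [_ defGm _ _] := dprodP defG; rewrite -cycle_subG -defGm mulG_subl. Qed.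

Lemma cdprod_memPr : b \in G.
Proof. by have [_ defGm _ _] := dprodP defG; rewrite -cycle_subG -defGm mulG_subr. Qed.

Lemma cdprod_gen : <<[set a; b]>> = G.
Proof.
have [_ <- cab _] := dprodP defG.
by rewrite -norm_joinEr ?cents_norm // joing_idl joing_idr.
Qed.

Lemma cdprod_index : #|G : <[a]>| = #[b].
Proof.
rewrite -divgS ?cycle_subG ?cdprod_memPl // -(dprod_card defG).
by rewrite mulKn ?cardG_gt0.
Qed.

(** If [p] does not divide [#[b]], then [P] lies in [<[a]>]. Otherwise [<[a]>] and [<[b]>] each
    supply a subgroup of order [p] in [P]; these meet trivially, while a cyclic group has only
    one. *)
Lemma cyclic_Sylow_cdprod p (P : {group gT}) :
  prime p -> p.-Sylow(G) P -> cyclic P = ~~ (p %| #[b]).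
Proof.
move=> p_pr sylP; have abG := cdprod_abelian.
have nPG : P <| G by rewrite -sub_abelian_normal ?(pHall_sub sylP).
apply/idP/idP => [cycP | p'b]; last first.
  apply: (@cyclicS _ <[a]>); last exact: cycle_cyclic.
  apply: (@sub_Hall_index _ p G); rewrite ?(pHall_sub sylP) ?(pHall_pgroup sylP) //.
    by rewrite -sub_abelian_normal ?cycle_subG ?cdprod_memPl.
  by rewrite cdprod_index p'natE.
apply/negP=> p_b; have p_a := dvdn_trans p_b dvd_ba.
have sub_P x : x \in G -> (p %| #[x])%N ->
    (<[x ^+ (#[x] %/ p)]> \subset P) && (#|<[x ^+ (#[x] %/ p)]>| == p).
  move=> Gx p_x; have ox : #[x ^+ (#[x] %/ p)] = p.
    by rewrite orderXdiv ?dvdn_div // divnA // mulKn.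
  rewrite [#|_|]ox eqxx andbT (sub_normal_Hall sylP) ?cycle_subG ?groupX //.
  by rewrite /pgroup [#|_|]ox pnat_id.
have /andP[sAP /eqP oA] := sub_P a cdprod_memPl p_a.
have /andP[sBP /eqP oB] := sub_P b cdprod_memPr p_b.
have eqAB : <[a ^+ (#[a] %/ p)]> = <[b ^+ (#[b] %/ p)]>.
  by apply/eqP; rewrite (eq_subG_cyclic cycP) // oA oB.
have [_ _ _ tiab] := dprodP defG.
have: <[a ^+ (#[a] %/ p)]> \subset <[a]> :&: <[b]>.
  by rewrite subsetI {2}eqAB !cycleX.
by rewrite tiab; move/trivgP=> A1; move: p_pr; rewrite -oA A1 cards1.
Qed.

Lemma cdprod_morphism (rT : finGroupType) (u v : rT) :
    commute u v -> #[u] %| #[a] -> #[v] %| #[b] ->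
  exists2 f : {morphism G >-> rT}, f a = u & f b = v.
Proof.
move=> cuv dvd_u dvd_v.
have cfg : eltm dvd_v @* <[b]> \subset 'C(eltm dvd_u @* <[a]>).
  by rewrite !im_eltm cent_cycle cycle_subG; apply/cent1P.
exists (dprodm_morphism defG cfg) => /=.
  by rewrite dprodmEl ?cycle_id //= eltm_id.
by rewrite dprodmEr ?cycle_id //= eltm_id.
Qed.

(* The kernel consists of [p]-th powers for every prime [p] dividing the order
   of [G], hence adds nothing to a proper subgroup. *)
Lemma cdprod_ker_nongen (rT : finGroupType) (f : {morphism G >-> rT})
    (J : {group gT}) :
    <[f a]> :&: <[f b]> = 1 ->
    (forall p, prime p -> p %| #[a] -> p %| #[f a])%N ->
    (forall p, prime p -> p %| #[b] -> p %| #[f b])%N ->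
  J \subset G -> f @* J = f @* G -> J :=: G.
Proof.
move=> tifab pi_a pi_b sJG eq_fJ; have abG := cdprod_abelian.
have nJG : J <| G by rewrite -sub_abelian_normal.
have [Ga Gb] := (cdprod_memPl, cdprod_memPr).
apply/eqP; rewrite eqEsubset sJG -indexg_eq1; apply/negPn/negP=> ntGJ.
pose p := pdiv #|G : J|.
have p_pr : prime p by rewrite pdiv_prime // ltn_neqAle eq_sym ntGJ /=.
have p_GJ : p %| #|G / J|.
  by rewrite card_quotient ?normal_norm // pdiv_dvd.
have root_b i : (#[f b] %| i)%N -> exists2 c, c \in G & b ^+ i = c ^+ p.
  move=> fb_i; have [p_b | p'b] := boolP (p %| #[b])%N.
    have /dvdnP[j ->] := dvdn_trans (pi_b p p_pr p_b) fb_i.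
    by exists (b ^+ j); rewrite ?groupX // expgM.
  (* Raising to the power [p] is invertible on [<[b]>], so every element there is a [p]-th power. *)
  have co_b : coprime #|<[b]>| p by rewrite coprime_sym prime_coprime.
  have bi_b : b ^+ i \in <[b]> by rewrite mem_cycle.
  exists ((b ^+ i) ^+ expg_invn <[b]> p); first by rewrite !groupX.
  by rewrite expgAC expgK.
have p_a : (p %| #[a])%N.
  have: (p %| #|<[a]>| * #|<[b]>|)%N.
    by rewrite (dprod_card defG) (dvdn_trans (pdiv_dvd _)) ?dvdn_indexg.
  by rewrite Euclid_dvdM // => /orP[//| /dvdn_trans-> //].
have root_ker g : g \in 'ker f -> exists2 c, c \in G & g = c ^+ p.
  move=> kg; have Gg := dom_ker kg.
  have [_ defGm _ _] := dprodP defG.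
  have /mulsgP[_ _ /cycleP[i ->] /cycleP[j ->] def_g] : g \in <[a]> * <[b]>.
    by rewrite defGm.
  have fab1 : f a ^+ i * f b ^+ j = 1.
    by rewrite -!morphX // -morphM ?groupX // -def_g (mker kg).
  (* As [<[f a]>] and [<[f b]>] meet trivially, both factors of the relation [fab1] vanish. *)
  have fa1 : f a ^+ i = 1.
    apply/set1P; rewrite -set1gE -tifab inE mem_cycle /=.
    by rewrite (canRL (mulgK _) fab1) mul1g groupV mem_cycle.
  have fb1 : f b ^+ j = 1 by rewrite fa1 mul1g in fab1.
  have /dvdnP[i' def_i] : (p %| i)%N.
    by rewrite (dvdn_trans (pi_a p p_pr p_a)) // order_dvdn fa1.
  have [|c Gc def_c] := root_b j; first by rewrite order_dvdn fb1.
  exists (a ^+ i' * c); first by rewrite groupM ?groupX.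
  rewrite expgMn; last by apply: (centsP abG); rewrite ?groupX.
  by rewrite -expgM -def_i -def_c.
(* [G] is covered by [J] and the kernel, whose elements are [p]-th powers, so the [p]-power map is
   onto the finite group [G / J], hence injective. An element of order [p] contradicts this. *)
have inj_p : {in G / J &, injective (fun x => x ^+ p)}.
  apply/imset_injP; rewrite eqn_leq leq_imset_card subset_leq_card //.
  apply/subsetP=> _ /morphimP[g Ng Gg ->].
  have: f g \in f @* J by rewrite eq_fJ mem_morphim.
  case/morphimP=> j Gj Jj fg_fj.
  have [|c Gc def_c] := root_ker (j^-1 * g).
    rewrite mem_morphpre ?groupM ?groupV // inE morphM ?groupV // morphV //.
    by rewrite fg_fj mulVg.
  apply/imsetP; exists (coset J c); first exact: mem_quotient.
  have NG := subsetP (normal_norm nJG).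
  rewrite -morphX ?NG // -def_c morphM ?groupV ?NG // morphV ?NG //=.
  by rewrite (coset_id Jj) invg1 mul1g.
have [x Gx ox] := Cauchy p_pr p_GJ.
have x1 : x = 1 by apply: inj_p; rewrite // expg1n -ox expg_order.
by move: p_pr; rewrite -ox x1 order1.
Qed.

End CyclicDprod.

(** * Degrees in the generating graph *)

Lemma graph_iso_sym (X Y : sgraph) : graph_iso X Y -> graph_iso Y X.
Proof.
case=> f [g fK gK] adj_f; exists g; first by exists f.
by move=> x y; rewrite -adj_f !gK.
Qed.

Lemma gen_adj_noncyclic (gT : finGroupType) (G : {group gT}) (x y : subg_of G) :
  ~~ cyclic G -> gen_adj x y = (<<[set sgval x; sgval y]>> == G).
Proof.
move=> ncycG; rewrite /gen_adj andb_idl // => genG.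
apply: contraNneq ncycG => eq_xy; apply/cyclicP; exists (sgval x).
by rewrite -(eqP genG) eq_xy setUid.
Qed.

Lemma grank2_noncyclic (gT : finGroupType) (G : {group gT}) :
  'm(G) = 2 -> ~~ cyclic G.
Proof.
move=> mG; apply/cyclicP=> [[x defG]].
have : (#|[set x]| >= 'm(<[x]>))%N by exact: grank_min.
by rewrite -defG mG cards1.
Qed.

(** The neighbour [z] ensures that [G / <[x]>] is cyclic; the neighbours of [x] then form the
    preimage of its set of generators. *)
Lemma card_gen_adj (gT : finGroupType) (G : {group gT}) (x z : subg_of G) :
    abelian G -> ~~ cyclic G -> gen_adj x z ->
  #|[set y | gen_adj x y]| = (#[sgval x] * totient #|G : <[sgval x]>|)%N.
Proof.
move=> abG ncycG; rewrite gen_adj_noncyclic // => genxz.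
have [Gx Gz] := (subgP x, subgP z).
set X := <[sgval x]>.
have nXG : X <| G by rewrite -sub_abelian_normal ?cycle_subG.
have NG := subsetP (normal_norm nXG).
have gen_quo y : y \in G -> (<<[set sgval x; y]>> == G) = (G / X == <[coset X y]>).
  move=> Gy; rewrite -quotient_cycle ?NG // [RHS]eq_sym.
  have -> : <<[set sgval x; y]>> = X <*> <[y]> by rewrite joing_idl joing_idr.
  rewrite -quotientYidl ?cycle_subG ?NG //.
  apply/eqP/eqP=> [-> //| eqQ].
  apply: (quotient_inj _ nXG eqQ).
  by rewrite /normal joing_subl join_subG normG cycle_subG NG.
have eqQ : G / X = <[coset X (sgval z)]> by apply/eqP; rewrite -gen_quo.
have -> : #|[set y | gen_adj x y]| =
          #|coset X @*^-1 [set t | generator (G / X) t]|.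
  rewrite -(card_imset _ (@subg_inj _ G)); apply: eq_card => y.
  apply/imsetP/morphpreP => [[y' ] | [Ny]]; rewrite inE.
    rewrite gen_adj_noncyclic // gen_quo ?subgP // => gen_y' ->.
    by split; [apply: NG; apply: subgP | rewrite inE].
  move=> gen_y; have Gy : y \in G.
    rewrite -(quotientGK nXG) mem_morphpre //.
    by rewrite (eqP gen_y) cycle_id.
  by exists (subg G y); rewrite ?inE ?gen_adj_noncyclic ?subgK ?gen_quo.
rewrite card_morphpre_set; last first.
  apply: subset_trans (quotientS X (normal_norm nXG)); apply/subsetP=> t.
  by rewrite inE => /eqP->; apply: cycle_id.
rewrite ker_coset -card_quotient ?normal_norm // eqQ totient_gen.
by rewrite -eqQ.
Qed.

(** The larger cyclic factor of [H] has index prime to [p]. Equality of degrees carries this over to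
    the subgroup generated by the image of its generator, which must therefore contain [P]. *)
Lemma graph_iso_cyclic_Sylow (gT hT : finGroupType) (G : {group gT})
    (H : {group hT}) p (P : {group gT}) (Q : {group hT}) :
    abelian G -> abelian H -> #|G| = #|H| -> 'm(G) = 2 -> 'm(H) = 2 ->
    graph_iso (generating_graph G) (generating_graph H) ->
    prime p -> p.-Sylow(G) P -> p.-Sylow(H) Q ->
  cyclic Q -> cyclic P.
Proof.
move=> abG abH oGH mG mH /graph_iso_sym[f /= bij_f adj_f] p_pr sylP sylQ.
have [a [b [defH dvd_ba]]] := abelian_rank2 abH mH.
rewrite (cyclic_Sylow_cdprod defH dvd_ba p_pr sylQ) => p'b.
have [ncG ncH] := (grank2_noncyclic mG, grank2_noncyclic mH).
pose a' := subg H a; pose b' := subg H b.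
have ab_adj : gen_adj a' b'.
  rewrite gen_adj_noncyclic // !subgK ?(cdprod_memPl defH) ?(cdprod_memPr defH) //.
  by rewrite (cdprod_gen defH).
have deg_a := card_gen_adj abH ncH ab_adj.
have := card_gen_adj abG ncG (_ : gen_adj (f a') (f b')).
rewrite adj_f => /(_ ab_adj).
have -> : #|[set y | gen_adj (f a') y]| = #|[set y | gen_adj a' y]|.
  rewrite -(on_card_preimset (f := f)); last exact: onW_bij.
  by apply: eq_card => y; rewrite !inE adj_f.
rewrite {}deg_a subgK ?(cdprod_memPl defH) // (cdprod_index defH).
set x := sgval (f a') => eq_deg.
have Gx : x \in G by apply: subgP.
have b_gt0 : (0 < #[b])%N by rewrite order_gt0.
have i_gt0 : (0 < #|G : <[x]>|)%N by rewrite indexg_gt0.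
have oG : (#[x] * #|G : <[x]>| = #[a] * #[b])%N.
  by rewrite Lagrange ?cycle_subG // oGH (dprod_card defH).
have eq_totient : (totient #[b] * #|G : <[x]>| = totient #|G : <[x]>| * #[b])%N.
  (* Cross-multiply the equality of degrees with the equality of group orders [oG]. *)
  apply/eqP; rewrite -(eqn_pmul2l (_ : 0 < #[x] * #[a])%N) ?muln_gt0 ?order_gt0 //.
  by rewrite [X in (X * _)%N == _]mulnC mulnACA eq_deg oG mulnACA.
have := totient_ratio_primes b_gt0 i_gt0 eq_totient p.
rewrite !mem_primes p_pr b_gt0 i_gt0 /= (negPf p'b) => p'i.
apply: (@cyclicS _ <[x]>); last exact: cycle_cyclic.
apply: (@sub_Hall_index _ p G); rewrite ?(pHall_sub sylP) ?(pHall_pgroup sylP) //.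
  by rewrite -sub_abelian_normal ?cycle_subG.
by rewrite p'natE // -p'i.
Qed.

(** * Matching fibres over a common image *)

(* Match the elements of each fibre by their positions in its enumeration. *)
Lemma fibre_bijection (S T W : finType) (u : S -> W) (v : T -> W) (y0 : T) :
    #|S| = #|T| ->
    (forall w, #|[pred x | u x == w]| = #|[pred y | v y == w]|) ->
  exists2 f : S -> T, bijective f & forall x, v (f x) = u x.
Proof.
move=> oST eq_fib.
pose A w := enum [pred x | u x == w]; pose B w := enum [pred y | v y == w].
(* The default [y0] is never returned: by [ltB] the index is always in range. *)
pose f x := nth y0 (B (u x)) (index x (A (u x))).
have ltB x : (index x (A (u x)) < size (B (u x)))%N.
  by rewrite -cardE -eq_fib cardE index_mem mem_enum inE.
have vf x : v (f x) = u x.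
  by apply/eqP; have := mem_nth y0 (ltB x); rewrite mem_enum.
exists f => //; apply: inj_card_bij; last by rewrite oST.
move=> x1 x2 eqf; have equ : u x1 = u x2 by rewrite -!vf eqf.
have /eqP := eqf; have := ltB x1.
rewrite /f equ => ltB1; rewrite nth_uniq ?enum_uniq ?ltB //.
have mA x : x \in A (u x) by rewrite mem_enum inE.
have mA1 := mA x1; rewrite equ in mA1.
by move/eqP/(congr1 (nth x1 (A (u x2)))); rewrite !nth_index.
Qed.

Lemma card_ker_morphim (gT rT : finGroupType) (G : {group gT})
    (f : {morphism G >-> rT}) : (#|'ker f| * #|f @* G|)%N = #|G|.
Proof. by rewrite card_morphim setIid Lagrange // subsetIl. Qed.

Lemma card_subg_fibre (gT rT : finGroupType) (G : {group gT})
    (f : {morphism G >-> rT}) w :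
  #|[pred x : subg_of G | f (sgval x) == w]| =
    (if w \in f @* G then #|'ker f| else 0)%N.
Proof.
have -> : #|[pred x : subg_of G | f (sgval x) == w]| = #|f @*^-1 [set w]|.
  rewrite -(card_imset _ (@subg_inj _ G)); apply: eq_card => y.
  apply/imsetP/morphpreP => [[x fx ->] | [Gy]].
    by rewrite subgP inE.
  by rewrite inE => fy; exists (subg G y); rewrite ?inE subgK.
have [fGw | fG'w] := ifPn; first by rewrite card_morphpre_set ?sub1set // cards1 muln1.
apply: eq_card0 => y; rewrite !inE; apply/negP=> /andP[Gy /eqP fy].
by rewrite -fy mem_morphim in fG'w.
Qed.

Lemma morphim_gen2 (gT rT : finGroupType) (G : {group gT})
    (f : {morphism G >-> rT}) x y :
  x \in G -> y \in G -> f @* <<[set x; y]>> = <<[set f x; f y]>>.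
Proof.
move=> Gx Gy; rewrite morphim_gen ?subUset ?sub1set ?Gx // morphimU.
by rewrite !morphim_set1.
Qed.

(** Adjacency can be tested in the image: a subgroup of [G] with full image is [G] by
    [cdprod_ker_nongen]. *)
Lemma cdprod_gen_morphim (gT rT : finGroupType) (G : {group gT}) a b
    (f : {morphism G >-> rT}) x y :
    <[a]> \x <[b]> = G -> #[b] %| #[a] ->
    <[f a]> :&: <[f b]> = 1 ->
    (forall p, prime p -> p %| #[a] -> p %| #[f a])%N ->
    (forall p, prime p -> p %| #[b] -> p %| #[f b])%N ->
    x \in G -> y \in G ->
  (<<[set x; y]>> == G) = (<<[set f x; f y]>> == f @* G).
Proof.
move=> defG dvd_ba tif pi_a pi_b Gx Gy; rewrite -morphim_gen2 //.
apply/eqP/eqP=> [-> // | eq_f].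
apply: (cdprod_ker_nongen defG dvd_ba tif pi_a pi_b _ eq_f).
by rewrite gen_subG subUset !sub1set Gx.
Qed.

Theorem theorem5p14 (gT hT : finGroupType) (G : {group gT}) (H : {group hT})
    (n : nat) (abG : abelian G) (abH : abelian H)
    (oG : #|G| = n) (oH : #|H| = n) (nisoGH : ~~ (G \isog H))
    (mG : 'm(G) = 2) (mH : 'm(H) = 2) :
  graph_iso (generating_graph G) (generating_graph H) <->
  (forall p : nat, prime p -> (p %| n)%N ->
     forall (P : {group gT}) (Q : {group hT}),
       p.-Sylow(G) P -> p.-Sylow(H) Q ->
       (cyclic P /\ cyclic Q) \/ (~~ cyclic P /\ ~~ cyclic Q)).
Proof.
have oGH : #|G| = #|H| by rewrite oG.
split=> [isoGH p p_pr _ P Q sylP sylQ | same_type].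
  have QP := graph_iso_cyclic_Sylow abG abH oGH mG mH isoGH p_pr sylP sylQ.
  have PQ := graph_iso_cyclic_Sylow abH abG (esym oGH) mH mG
               (graph_iso_sym isoGH) p_pr sylQ sylP.
  have [cycP | ncycP] := boolP (cyclic P); first by left; rewrite PQ.
  by right; split=> //; apply: contra ncycP.
have [a [b [defG dvd_ba]]] := abelian_rank2 abG mG.
have [c [d [defH dvd_dc]]] := abelian_rank2 abH mH.
(* Orders for the common image: [m] divides [#[a]] and [#[c]] and, by [pi_ac], keeps all their
   primes; likewise [k] for [#[b]] and [#[d]], by [pi_bd]. *)
pose m := gcdn #[a] #[c]; pose k := gcdn #[b] #[d].
(* Since [#[b]] divides [#[a]] and [#[d]] divides [#[c]], both sides say that [p] divides the common
   group order. *)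
have pi_ac p : prime p -> (p %| #[a] = (p %| #[c]))%N.
  have := oGH; rewrite -(dprod_card defG) -(dprod_card defH) => oab p_pr.
  have := congr1 (dvdn p) oab; rewrite !Euclid_dvdM //.
  have [p_b | ] := boolP (p %| #|<[b]>|)%N; have [p_d | ] := boolP (p %| #|<[d]>|)%N.
  - by rewrite (dvdn_trans p_b dvd_ba) (dvdn_trans p_d dvd_dc).
  - by rewrite (dvdn_trans p_b dvd_ba) orbF.
  - by rewrite (dvdn_trans p_d dvd_dc) orbF.
  by rewrite !orbF.
have pi_bd p : prime p -> (p %| #[b] = (p %| #[d]))%N.
  move=> p_pr; have [p_n | p'n] := boolP (p %| n)%N; last first.
    apply/idP/idP=> p_x; case/negP: p'n; apply: (dvdn_trans p_x).
      by rewrite -oG order_dvdG ?(cdprod_memPr defG).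
    by rewrite -oH order_dvdG ?(cdprod_memPr defH).
  have [P sylP] := Sylow_exists p G; have [Q sylQ] := Sylow_exists p H.
  have := same_type p p_pr p_n P Q sylP sylQ.
  rewrite (cyclic_Sylow_cdprod defG dvd_ba p_pr sylP).
  rewrite (cyclic_Sylow_cdprod defH dvd_dc p_pr sylQ) !negbK.
  by case=> [[/negPf-> /negPf->] | [-> ->]].
(* The common image is realised inside [G], by powers of [a] and [b] of orders [m] and [k]. *)
pose u := a ^+ (#[a] %/ m); pose v := b ^+ (#[b] %/ k).
have div_order (x : gT) q : (q %| #[x])%N -> #[x ^+ (#[x] %/ q)] = q.
  by move=> q_x; rewrite orderXdiv ?dvdn_div // divnA // mulKn ?order_gt0.
have ou : #[u] = m by rewrite div_order ?dvdn_gcdl.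
have ov : #[v] = k by rewrite div_order ?dvdn_gcdl.
have cuv : commute u v.
  by apply: (centsP abG); rewrite groupX ?(cdprod_memPl defG) ?(cdprod_memPr defG).
have tiuv : <[u]> :&: <[v]> = 1.
  have [_ _ _ tiab] := dprodP defG.
  by apply/trivgP; rewrite -tiab setISS ?cycleX.
have [f fa fb] : exists2 f : {morphism G >-> gT}, f a = u & f b = v.
  by apply: (cdprod_morphism defG cuv); rewrite ?ou ?ov dvdn_gcdl.
have [g gc gd] : exists2 g : {morphism H >-> gT}, g c = u & g d = v.
  by apply: (cdprod_morphism defH cuv); rewrite ?ou ?ov dvdn_gcdr.
have imf : f @* G = <<[set u; v]>>.
  rewrite -fa -fb -morphim_gen2 ?(cdprod_memPl defG) ?(cdprod_memPr defG) //.
  by rewrite (cdprod_gen defG).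
have img : g @* H = <<[set u; v]>>.
  rewrite -gc -gd -morphim_gen2 ?(cdprod_memPl defH) ?(cdprod_memPr defH) //.
  by rewrite (cdprod_gen defH).
have oker : #|'ker f| = #|'ker g|.
  apply/eqP; rewrite -(eqn_pmul2r (cardG_gt0 (f @* G))); apply/eqP.
  by rewrite /= card_ker_morphim oGH -(card_ker_morphim g) imf img.
have [h bij_h gh] : exists2 h : subg_of G -> subg_of H,
    bijective h & forall x, g (sgval (h x)) = f (sgval x).
  apply: (@fibre_bijection _ _ _ (f \o sgval) (g \o sgval) 1) => [|w].
    by rewrite !card_sub.
  (* Over the common image all fibres have the same kernel order; elsewhere both are empty. *)
  by rewrite (card_subg_fibre f) (card_subg_fibre g) imf img oker.
exists h => // x y /=; have [ncG ncH] := (grank2_noncyclic mG, grank2_noncyclic mH).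
rewrite !gen_adj_noncyclic //.
rewrite (cdprod_gen_morphim (f := f) defG dvd_ba) ?subgP // ?fa ?fb //; first last.
- by move=> p p_pr p_b; rewrite ov dvdn_gcd p_b -pi_bd.
- by move=> p p_pr p_a; rewrite ou dvdn_gcd p_a -pi_ac.
rewrite (cdprod_gen_morphim (f := g) defH dvd_dc) ?subgP // ?gc ?gd //; first last.
- by move=> p p_pr p_b; rewrite ov dvdn_gcd p_b pi_bd ?p_b.
- by move=> p p_pr p_a; rewrite ou dvdn_gcd p_a pi_ac ?p_a.
by rewrite !gh imf img.
Qed.
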